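(* Let $r=2^b-1$ be a Mersenne prime. Consider the following two subgroups of $\Gamma(r^2)=N\langle\phi\rangle$: $P_1=O_2(N)\langle\phi\rangle$ (a semidihedral group of size $2^{b+2}$) and $P_2=(O_2(N))^2\langle\phi\rangle$ (a dihedral group of size $2^{b+1}$). If $G=PC\le\Gamma(r^2)$ with $P\in\{P_1,P_2\}$ and $C\le O_{2'}(N)$, then $G$ is an irreducible nilpotent IBIS subgroup of $\Gamma(r^2)$ and $b(G)=2$.
   Context: $\Gamma(r^2)=\{x\mapsto ax^{\sigma}\mid a\in \mathrm{GF}(r^2)^*,\ \sigma\in \mathrm{Gal}(\mathrm{GF}(r^2)/\mathrm{GF}(r))\}$ is the semilinear group acting on $V=\mathrm{GF}(r^2)$, a 2-dimensional vector space over $\mathrm{GF}(r)$. $N$ is the cyclic normal subgroup of order $r^2-1$ consisting of the maps $x\mapsto ax$, and $\phi$ is the map $x\mapsto x^r$. $O_2(N)$ and $O_{2'}(N)$ are the largest subgroup of $N$ of 2-power order and of odd order respectively, and $(O_2(N))^2=\{x^2\mid x\in O_2(N)\}$. For a finite permutation group $G$ on $\Omega$, a sequence $(\omega_1,\dots,\omega_t)$ is an irredundant base if its pointwise stabilizer is trivial and no $\omega_i$ is fixed by the pointwise stabilizer of its predecessors. $G$ is IBIS if all its irredundant bases have the same cardinality. A linear group on $V$ is called IBIS if it induces an IBIS permutation group on $V\setminus\{0\}$. $b(G)$ (not to be confused with the exponent $b$) denotes the smallest cardinality of a base (subset with trivial pointwise stabilizer) for the action of $G$ on $V\setminus\{0\}$.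 *)

(* Defs.v *)
From HB Require Import structures.
From mathcomp Require Import all_boot all_order all_algebra all_fingroup.
From mathcomp Require Import all_solvable all_field.

Set Implicit Arguments.
Unset Strict Implicit.
Unset Printing Implicit Defensive.

Import GRing.Theory.
Local Open Scope group_scope.

Section PermutationBases.

Variables (T : finType) (G : {set {perm T}}) (S : {set T}).

(* Throughout, G is meant to act faithfully on S (as a linear group does on  *)
(* the nonzero vectors), so triviality of a stabiliser can be tested in G.   *)

Definition is_base (B : {set T}) : bool :=
  (B \subset S) && ('C_G(B | 'P) == 1).

(* Junk value #|S| if no base exists, i.e., if G is not faithful on S. *)
Definition base_size : nat := #|[arg min_(B < S | is_base B) #|B|]|.

Definition irredundant_base (s : seq T) : Prop :=
  is_base [set x in s] /\
  (forall (u v : seq T) (w : T), s = u ++ w :: v ->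
     ~~ ('C_G([set x in u] | 'P) \subset 'C[w | 'P])).

Definition ibis : Prop :=
  forall s t : seq T,
    irredundant_base s -> irredundant_base t -> size s = size t.

End PermutationBases.

Section SemilinearGroup.

(* K = GF(r) and L = GF(r^d); finvect_type L is L itself, endowed with its   *)
(* finite type structure.                                                    *)
Variables (K : finFieldType) (L : fieldExtType K).
Local Notation V := (finvect_type L).

Definition nonzero_vectors : {set V} := [set~ 0%R].

Definition linear_group (G : {set {perm V}}) : Prop :=
  forall g : {perm V}, g \in G -> linear (g : V -> V).

Definition irreducible_linear_group (G : {set {perm V}}) : Prop :=
  [/\ linear_group G,
      {:V}%VS <> 0%VS
    & forall W : {vspace V},
        (forall (g : {perm V}) (w : V), g \in G -> w \in W -> g w \in W) ->
        W = 0%VS \/ W = {:V}%VS].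

Definition linear_ibis (G : {set {perm V}}) : Prop := ibis G nonzero_vectors.

Definition linear_base_size (G : {set {perm V}}) : nat :=
  base_size G nonzero_vectors.

Definition semilinear_group : {set {perm V}} :=
  [set g : {perm V} | [exists a : V, [exists s in 'Gal({:V} / 1%AS),
     (a != 0%R) && [forall x : V, g x == (a * s x)%R]]]].

Definition scalings : {set {perm V}} :=
  [set g : {perm V} |
     [exists a : V, (a != 0%R) && [forall x : V, g x == (a * x)%R]]].

Lemma frobenius_inj : injective (fun x : V => (x ^+ #|K|)%R).
Proof.
have iterE n (x : V) :
    iter n (fun y : V => (y ^+ #|K|)%R) x = (x ^+ (#|K| ^ n))%R.
  by elim: n => [|n IHn]; rewrite ?expr1 // iterS IHn -GRing.exprM -expnSr.
have cardV : #|V| = (#|K| ^ \dim {:V})%N by rewrite -card_vspace card_vspacef.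
have dim_gt0 : (0 < \dim {:V})%N by rewrite (adim_gt0 (aspacef V)).
move=> x y /= eq_xy.
rewrite -(expf_card x) -(expf_card y) cardV -!iterE -(prednK dim_gt0) !iterSr.
by rewrite eq_xy.
Qed.

Definition frobenius : {perm V} := perm frobenius_inj.

Definition P1 : {set {perm V}} := 'O_2(scalings) * <[frobenius]>.

Definition P2 : {set {perm V}} :=
  [set x ^+ 2 | x in 'O_2(scalings)] * <[frobenius]>.

End SemilinearGroup.

Arguments semilinear_group {K} L.
Arguments scalings {K} L.
Arguments frobenius {K} L.
Arguments P1 {K} L.
Arguments P2 {K} L.

(* Main.v *)
Require Import Defs.
From HB Require Import structures.
From mathcomp Require Import all_boot all_order all_algebra all_fingroup.
From mathcomp Require Import all_solvable all_field zify.

Set Implicit Arguments.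
Unset Strict Implicit.
Unset Printing Implicit Defensive.

Import GRing.Theory.
Local Open Scope group_scope.

(** Write q = #|K|, N for the scalings and phi for the Frobenius map, and let
    [L : K] = 2.

    The base statements rest on one observation: a permutation group that is
    faithful on S and whose point stabilisers on S all have prime order is IBIS
    with bases of size 2, since once a point is fixed, any further point that is
    moved kills the prime-order stabiliser
    ([prime_stab_ibis], [prime_stab_base_size]).

    In the semilinear group N <phi> the stabiliser of 1 is <phi>, of order 2. As N
    is transitive on nonzero vectors, the stabiliser of s(1), for s in N, is the
    conjugate <phi>^s. Now phi^s = phi s^(1-q), because phi raises scalings to the
    power q; so a subgroup H <phi> with H in N contains all these stabilisers as
    soon as H contains N^(q-1) ([point_stabE]). The same condition forces
    irreducibility: an invariant line would put the (q-1)-th power of a generator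
    of the multiplicative group of L inside K, making q^2-1 divide (q-1)^2
    ([scalings_frobenius_irreducible]).

    When q = 2^b-1 is prime, put k = 2^(b-1)-1, an odd number. Then q-1 = 2k and
    |N| = 2^(b+1) k, so s^(q-1) = (s^k)^2 is the square of an element of O_2(N):
    the condition above holds as soon as H contains the squares of O_2(N)
    ([scalings_expg_pred]). Elements of O_2'(N) have order dividing k, hence
    dividing q-1, so they commute with phi; therefore G = P C is the product of a
    2-group and a central abelian group, and is nilpotent
    ([mul_frobenius_central_mul]). Finally phi acts on the cyclic group O_2(N) of
    order 2^(b+1) by x |-> x^(2^b-1) and inverts its squares, which are the
    presentations of the semidihedral and dihedral groups
    ([O2_frobenius_isog], [squares_frobenius_isog]). *)

(** * Permutation groups whose point stabilisers have prime order *)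

Section PrimePointStabilisers.

Variables (T : finType) (G : {group {perm T}}) (S : {set T}).
Hypothesis S_neq0 : S != set0.
Hypothesis faithfulS : 'C_G(S | 'P) = 1.
Hypothesis prime_stab : forall v, v \in S -> prime #|'C_G[v | 'P]|.

Lemma stab_pair_trivial v w :
    v \in S -> ~~ ('C_G[v | 'P] \subset 'C[w | 'P]) ->
  'C_G([set v; w] | 'P) = 1.
Proof.
move=> Sv not_fix_w; rewrite astabU setIA; apply: prime_TIg => //.
exact: prime_stab.
Qed.

(** A set with at most one point lies in some [set v] with v in S (S being
    nonempty), so its pointwise stabiliser contains that of v, of prime order. *)
Lemma base_card_gt1 B : is_base G S B -> (1 < #|B|)%N.
Proof.
case/andP=> sBS /eqP trivB; rewrite ltnNge; apply/negP=> leB1.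
have [v Sv sBv]: exists2 v, v \in S & B \subset [set v].
  have [-> | [v Bv]] := set_0Vmem B.
    by have /set0Pn[v Sv] := S_neq0; exists v; rewrite ?sub0set.
  exists v; first exact: (subsetP sBS).
  by have /eqP-> : [set v] == B by rewrite eqEcard sub1set Bv cards1.
have /prime_gt1 := prime_stab Sv; rewrite cardG_gt1 => /negP[].
by rewrite -subG1 -trivB setIS ?astabS.
Qed.

(** The first two entries of an irredundant base already have trivial pointwise
    stabiliser, so a third entry would be fixed by it. *)
Lemma irredundant_base_size2 s : irredundant_base G S s -> size s = 2.
Proof.
case=> base_s irr_s; have := base_card_gt1 base_s.
case: s => [|v [|w s]] in base_s irr_s *.
- by rewrite set_nil cards0.
- by rewrite set_cons set_nil setU0 cards1.
move=> _; have Sv : v \in S.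
  by case/andP: base_s => /subsetP-> //; rewrite !inE eqxx.
have set1E : [set x in [:: v]] = [set v] by rewrite set_cons set_nil setU0.
have set2E : [set x in [:: v; w]] = [set v; w] by apply/setP=> x; rewrite !inE.
have := irr_s [:: v] s w erefl; rewrite set1E => /(stab_pair_trivial Sv) triv_vw.
case: s => [//|x s] in base_s irr_s *.
by have := irr_s [:: v; w] s x erefl; rewrite set2E triv_vw sub1G.
Qed.

Lemma prime_stab_ibis : ibis G S.
Proof. by move=> s t /irredundant_base_size2-> /irredundant_base_size2->. Qed.

Lemma prime_stab_base_size : base_size G S = 2.
Proof.
have baseS : is_base G S S by rewrite /is_base subxx faithfulS /=.
rewrite /base_size; case: arg_minnP => // B baseB minB.
apply/eqP; rewrite eqn_leq base_card_gt1 // andbT.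
have /set0Pn[v Sv] := S_neq0.
have : ~~ ('C_G[v | 'P] \subset 'C(S | 'P)).
  apply/negP=> sub_v; have /prime_gt1 := prime_stab Sv.
  by rewrite cardG_gt1 -subG1 -faithfulS subsetI subsetIl sub_v.
case/subsetPn=> g Gvg /astabP not_fix.
have [w Sw gw] : exists2 w, w \in S & g w != w.
  apply/exists_inP; rewrite -negb_forall_in; apply/negP=> /forall_inP fixS.
  by apply: not_fix => w /fixS/eqP.
have base2 : is_base G S [set v; w].
  rewrite /is_base subUset !sub1set Sv Sw stab_pair_trivial //=.
  by apply/subsetPn; exists g => //; apply/astab1P/eqP.
by apply: leq_trans (minB _ base2) _; rewrite cards2; case: (v != w).
Qed.

End PrimePointStabilisers.

(** * Scalings, the Frobenius map and the semilinear group *)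

Section SemilinearGroups.

Variables (K : finFieldType) (L : fieldExtType K).
Local Notation V := (finvect_type L).
Local Notation N := (scalings L).
Local Notation phi := (frobenius L).
Local Notation q := #|K|.
Local Notation e1 := (GRing.one V).

Lemma scalingP (g : {perm V}) :
  reflect (exists2 a : V, a != 0%R & forall x, g x = (a * x)%R) (g \in N).
Proof.
rewrite inE; apply: (iffP existsP) => [[a /andP[a0 /forallP ga]] | [a a0 ga]].
  by exists a => // x; apply/eqP.
by exists a; rewrite a0; apply/forallP=> x; rewrite ga.
Qed.

(** Presenting the scalings as the image of the group of units under an injective
    morphism transports the group structure, the order and the cyclicity of the
    multiplicative group of a finite field. *)
Definition scale_perm (u : {unit V}) : {perm V} := perm (mulrI (valP u)).

Lemma scale_permM : {in [set: {unit V}] &, {morph scale_perm : u v / u * v}}.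
Proof. by move=> u v _ _; apply/permP=> x; rewrite permM !permE /= mulrCA mulrA. Qed.

Canonical scale_morphism := Morphism scale_permM.

Lemma scale_perm_injm : 'injm scale_perm.
Proof.
apply/injmP=> u v _ _ /permP/(_ 1%R); rewrite !permE !mulr1 => eq_uv.
exact: val_inj.
Qed.

Lemma scalingsE : N = scale_perm @* [set: {unit V}].
Proof.
apply/setP=> g; apply/scalingP/morphimP=> [[a a0 ga] | [u _ _ ->]].
  have Ua : a \is a GRing.unit by rewrite unitfE.
  by exists (FinRing.Unit Ua); rewrite ?inE //; apply/permP=> x; rewrite permE ga.
by exists (val u) => [|x]; rewrite ?permE // -unitfE (valP u).
Qed.

Lemma scalings_group_set : group_set N.
Proof. by rewrite scalingsE groupP. Qed.
Canonical scalings_group := group scalings_group_set.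

Lemma scalings_cyclic : cyclic N.
Proof. by rewrite scalingsE morphim_cyclic ?field_unit_group_cyclic. Qed.

Lemma card_scalings : #|N| = (q ^ \dim {:L}).-1.
Proof.
rewrite scalingsE card_injm ?scale_perm_injm // card_finField_unit.
have cardV : #|V| = (q ^ \dim {:V})%N by rewrite -card_vspace card_vspacef.
by rewrite cardV.
Qed.

(** The scalar of a scaling g is its value at 1, which avoids carrying an
    existential witness around. *)
Lemma scaling_expg g n x : g \in N -> (g ^+ n) x = ((g e1) ^+ n * x)%R.
Proof.
case/scalingP=> a a0 ga; rewrite ga mulr1.
elim: n x => [|n IHn] x; first by rewrite perm1 mul1r.
by rewrite expgSr permM IHn ga mulrA -exprS.
Qed.

Lemma scalingE g x : g \in N -> g x = (g e1 * x)%R.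
Proof. by move/(scaling_expg 1 x); rewrite expg1 expr1. Qed.

Lemma scaling1_eq1 g : g \in N -> g e1 = 1%R -> g = 1.
Proof. by move=> Ng g1; apply/permP=> x; rewrite scalingE // g1 mul1r perm1. Qed.

Lemma scaling_of (v : V) : v != 0%R -> exists2 s, s \in N & s e1 = v.
Proof.
move=> v0; have Uv : v \is a GRing.unit by rewrite unitfE.
exists (scale_perm (FinRing.Unit Uv)); last by rewrite permE /= mulr1.
by rewrite scalingsE mem_morphim ?inE.
Qed.

Lemma frobeniusE (x : V) : phi x = (x ^+ q)%R.
Proof. by rewrite permE. Qed.

Lemma frobenius_iter i (x : V) : (phi ^+ i) x = (x ^+ (q ^ i))%R.
Proof.
elim: i x => [|i IHi] x; first by rewrite perm1 expr1.
by rewrite expgSr permM IHi frobeniusE -exprM expnSr.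
Qed.

Lemma frobenius_fix1 g : g \in <[phi]> -> g e1 = 1%R.
Proof. by case/cycleP=> i ->; rewrite frobenius_iter expr1n. Qed.

(** Conjugating y |-> a y by the Frobenius map x |-> x ^ q gives
    x |-> (a x^(1/q))^q = a^q x. *)
Lemma scaling_conj_frobenius g : g \in N -> g ^ phi = g ^+ q.
Proof.
move=> Ng; apply/permP=> x; rewrite -[x](permKV phi) permJ frobeniusE scalingE //.
by rewrite scaling_expg // exprMn frobeniusE.
Qed.

Lemma frobenius_norm (H : {group {perm V}}) : H \subset N -> <[phi]> \subset 'N(H).
Proof.
move=> sHN; rewrite cycle_subG inE; apply/subsetP=> _ /imsetP[h Hh ->].
by rewrite scaling_conj_frobenius ?groupX // (subsetP sHN).
Qed.

Lemma scalings_frobenius_TI : N :&: <[phi]> = 1.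
Proof.
apply/trivgP/subsetP=> g /setIP[Ng /frobenius_fix1 g1].
by rewrite inE (scaling1_eq1 Ng).
Qed.

(** The Galois group of an extension of a finite field is generated by the
    Frobenius automorphism. *)
Lemma semilinear_groupE : semilinear_group L = N * <[phi]>.
Proof.
have [alpha /eqP genGal alphaE] := finField_galois_generator (sub1v {:V}).
have iterE i x : (alpha ^+ i) x = (phi ^+ i) x.
  rewrite frobenius_iter; elim: i => [|i IHi]; first by rewrite gal_id expr1.
  rewrite expgSr galM ?memvf // IHi alphaE ?memvf // -exprM expnSr.
  by rewrite dimv1 expn1.
apply/setP=> g; rewrite -(normC (frobenius_norm (subxx N))) inE.
apply/existsP/mulsgP=> [[a /exists_inP[s]] | [f n /cycleP[i ->] Nn ->]].
  rewrite genGal => /cycleP[i ->] /andP[a0 /forallP gE].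
  have [n Nn n1] := scaling_of a0.
  exists (phi ^+ i) n => //; first exact: mem_cycle.
  by apply/permP=> x; rewrite permM (scalingE _ Nn) n1 -iterE; apply/eqP.
have [a a0 nE] := scalingP _ Nn; exists a; apply/exists_inP.
exists (alpha ^+ i); first by rewrite genGal mem_cycle.
by rewrite a0; apply/forallP=> x; rewrite permM nE iterE.
Qed.

Lemma semilinear_is_linear : linear_group (semilinear_group L).
Proof.
move=> g; rewrite inE => /existsP[a /exists_inP[s _ /andP[_ /forallP gE]]] k x y.
by rewrite !(eqP (gE _)) linearP mulrDr scalerAr.
Qed.

(** * Subgroups generated by scalings and the Frobenius map *)

Section ScalingsByFrobenius.

Variables (H G : {group {perm V}}).
Hypothesis sHN : H \subset N.
Hypothesis defG : G :=: H * <[phi]>.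
Hypothesis powH : forall s, s \in N -> s ^+ q.-1 \in H.

Let sGsemi : G \subset semilinear_group L.
Proof. by rewrite defG semilinear_groupE mulSg. Qed.

(** The scaling s carries 1 to s(1) and the stabiliser of 1 in the semilinear group
    is <phi>, so the stabiliser of s(1) there is <phi>^s; the hypothesis on (q-1)-th
    powers is what puts this conjugate inside G. *)
Lemma point_stabE s : s \in N -> 'C_G[s e1 | 'P] = <[phi]> :^ s.
Proof.
move=> Ns; have Gphis : phi ^ s \in G.
  have -> : phi ^ s = phi * (s^-1) ^+ q.-1.
    rewrite conjgE mulgA [s^-1 * phi]conjgC scaling_conj_frobenius ?groupV //.
    by rewrite -(ltn_predK (finNzRing_gt1 K)) expgSr mulgA mulgKV.
  rewrite defG -(normC (frobenius_norm sHN)) mem_mulg ?cycle_id //.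
  by rewrite powH ?groupV.
apply/eqP; rewrite eqEsubset; apply/andP; split.
  apply/subsetP=> g /setIP[Gg /astab1P gs].
  have nNphi := frobenius_norm (subxx N).
  have : g ^ s^-1 \in N <*> <[phi]>.
    apply: groupJ; last by rewrite groupV (subsetP (joing_subl _ _)).
    by rewrite /= norm_joinEr // -semilinear_groupE (subsetP sGsemi).
  rewrite norm_joinEr // => /mulsgP[n f Nn Pf defg].
  have n1 : n e1 = e1.
    apply: (@perm_inj _ f); rewrite (frobenius_fix1 Pf) -permM -defg.
    by rewrite -{1}[e1](permK s) permJ [g _]gs permK.
  by rewrite mem_conjg defg (scaling1_eq1 Nn n1) mul1g.
rewrite subsetI -cycleJ cycle_subG Gphis /= cycleJ.
apply/subsetP=> _ /imsetP[f Pf ->].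
by apply/astab1P; rewrite /= apermE permJ (frobenius_fix1 Pf).
Qed.

(** With d = [L : K], x^(q^d) = x on L gives phi^d = 1; and if phi were trivial,
    every element of L would be a root of X^q - X, hence lie in K. *)
Lemma frobenius_order_prime : prime (\dim {:L}) -> #[phi] = \dim {:L}.
Proof.
move=> dim_prime.
have cardV : #|V| = (q ^ \dim {:V})%N by rewrite -card_vspace card_vspacef.
apply: nt_prime_order => //.
  by apply/permP=> x; rewrite frobenius_iter perm1 -cardV expf_card.
apply/eqP=> phi1; have := prime_gt1 dim_prime; rewrite ltnNge => /negP[].
rewrite -[X in (_ <= X)%N](dimv1 L); apply: dimvS; apply/subvP=> x _.
rewrite (Fermat's_little_theorem 1%AS) dimv1 expn1.
by rewrite -[(x ^+ q)%R]frobeniusE phi1 perm1.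
Qed.

(** Every point stabiliser is a conjugate of the group generated by the Frobenius
    map, whose order is prime, so the criterion on prime point stabilisers
    applies. *)
Lemma scalings_frobenius_ibis :
  prime (\dim {:L}) -> linear_ibis G /\ linear_base_size G = 2.
Proof.
move=> dim_prime.
have neS : nonzero_vectors L != set0.
  by apply/set0Pn; exists e1; rewrite !inE oner_eq0.
have faith : 'C_G(nonzero_vectors L | 'P) = 1.
  apply/trivgP/subsetP=> g /setIP[Gg /astabP fixg]; rewrite inE.
  have /semilinear_is_linear lin_g := subsetP sGsemi g Gg.
  apply/eqP/permP=> x; rewrite perm1; have [-> | x0] := eqVneq x 0%R.
    by have := lin_g (-1)%R 0%R 0%R; rewrite scaler0 scaleN1r addNr addr0.
  by apply: fixg; rewrite !inE.
have pr_stab v : v \in nonzero_vectors L -> prime #|'C_G[v | 'P]|.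
  rewrite !inE => /scaling_of[s Ns <-].
  by rewrite point_stabE // cardJg -orderE frobenius_order_prime.
by split; [apply: prime_stab_ibis | apply: prime_stab_base_size].
Qed.

(** A proper nonzero invariant subspace is a line K w. If z generates N, then
    z^(q-1) lies in G, so the (q-1)-th power of the scalar of z maps w into K w and
    lies in K. It is thus killed by q-1, and |N| = (q-1)(q+1) divides (q-1)^2. *)
Lemma scalings_frobenius_irreducible :
  \dim {:L} = 2 -> irreducible_linear_group G.
Proof.
move=> dim2; split=> [g Gg | V0 | W stabW].
- exact: semilinear_is_linear (subsetP sGsemi g Gg).
- by have := dim2; rewrite -[\dim _]/(\dim {:V}) V0 dimv0.
have [-> | W0] := eqVneq W 0%VS; [by left | right].
apply/eqP; rewrite eqEdim subvf /=.
rewrite -[X in (X <= _)%N]/(\dim {:L}) dim2 ltnNge; apply/negP=> dimW1.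
have w0 : vpick W != 0%R by rewrite vpick0.
have defW : (<[vpick W]> == W)%VS.
  by rewrite eqEdim -memvE memv_pick dim_vline w0.
have [z defN] := cyclicP scalings_cyclic.
have Nz : z \in N by rewrite defN cycle_id.
have Hzq : z ^+ q.-1 \in H by apply: powH.
have : (z ^+ q.-1) (vpick W) \in W.
  by apply: stabW (memv_pick W); rewrite defG -[_ ^+ _]mulg1 mem_mulg.
rewrite -{2}(eqP defW) => /vlineP[k]; rewrite scaling_expg // => kE.
have zkE : (z e1 ^+ q.-1 = k%:A)%R.
  by apply: (mulIf w0); rewrite kE mulr_algl.
have : ((z e1 ^+ q.-1) ^+ q == z e1 ^+ q.-1)%R.
  have := Fermat's_little_theorem 1%AS (z e1 ^+ q.-1)%R.
  by rewrite dimv1 expn1 zkE memvZ ?memv_line // => <-.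
move=> /eqP zqq; have : z ^+ (q.-1 * q.-1) = 1.
  apply: (mulIg (z ^+ q.-1)); rewrite mul1g -expgD -mulnSr.
  rewrite (ltn_predK (finNzRing_gt1 K)).
  by apply/permP=> x; rewrite !scaling_expg // exprM zqq.
move/eqP; rewrite -order_dvdn orderE -defN card_scalings dim2.
have := finNzRing_gt1 K; case: (#|K|) => [|[|m]] // _.
(* q = m + 2, so |N| = (m + 1)(m + 3) would divide (m + 1)^2. *)
have -> : ((m.+2 ^ 2).-1 = m.+1 * m.+3)%N by rewrite -mulnn; lia.
by rewrite [m.+2.-1]/= dvdn_pmul2l // => /dvdn_leq; lia.
Qed.

End ScalingsByFrobenius.
End SemilinearGroups.

(** * The Mersenne case *)

Lemma imset_expg_cycle (gT : finGroupType) (x : gT) n :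
  [set y ^+ n | y in <[x]>] = <[x ^+ n]>.
Proof.
apply/setP=> z; apply/imsetP/cycleP=> [[_ /cycleP[i ->] ->] | [i ->]].
  by exists i; rewrite -!expgM mulnC.
by exists (x ^+ i); rewrite ?mem_cycle // -!expgM mulnC.
Qed.

Section Mersenne.

Variables (b : nat) (K : finFieldType) (L : fieldExtType K).
Hypothesis r_prime : prime (2 ^ b - 1)%N.
Hypothesis cardK : #|K| = (2 ^ b - 1)%N.
Hypothesis dimL : \dim {:L} = 2.
Local Notation V := (finvect_type L).
Local Notation N := (scalings L).
Local Notation phi := (frobenius L).
Local Notation k := (2 ^ b.-1 - 1)%N.

Lemma mersenne_exponent_gt1 : (1 < b)%N.
Proof. by case: b r_prime => [|[|n]]. Qed.

Lemma expn2_pred : (2 ^ b = 2 * 2 ^ b.-1)%N.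
Proof. by rewrite -expnS (ltn_predK mersenne_exponent_gt1). Qed.

Lemma card_pred : #|K|.-1 = (2 * k)%N.
Proof. by rewrite cardK expn2_pred; lia. Qed.

Lemma card_scalings_mersenne : #|N| = (2 ^ b.+1 * k)%N.
Proof.
rewrite card_scalings dimL cardK -mulnn expnS expn2_pred.
by have := expn_gt0 2 b.-1; nia.
Qed.

Lemma odd_cofactor : odd k.
Proof.
rewrite oddB ?expn_gt0 // oddX /=.
by have := mersenne_exponent_gt1; case: b => [|[|n]].
Qed.

Lemma card_O2_scalings : #|'O_2(N)| = (2 ^ b.+1)%N.
Proof.
rewrite (card_Hall (nilpotent_pcore_Hall 2 (abelian_nil (cyclic_abelian _)))) /=.
  rewrite card_scalings_mersenne partnM ?expn_gt0 //; last by case: k odd_cofactor.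
  rewrite part_pnat_id ?pnatX // part_p'nat ?muln1 //.
  by rewrite p'natE // dvdn2 odd_cofactor.
exact: scalings_cyclic.
Qed.

(** The order of x is odd and divides |N| = 2^(b+1) k. *)
Lemma O2'_scalings_expg x : x \in 'O_2^'(N) -> x ^+ k = 1.
Proof.
move=> Ox; apply/eqP; rewrite -order_dvdn.
have o'x : (2^'.-nat #[x])%N by apply: mem_p_elt (pcore_pgroup _ _) Ox.
rewrite -(@Gauss_dvdr _ (2 ^ b.+1)).
  by rewrite -card_scalings_mersenne order_dvdG // (subsetP (pcore_sub 2^' N)).
by rewrite coprime_sym; apply: pnat_coprime o'x; rewrite pnatX.
Qed.

(** s^(q-1) = (s^k)^2, and s^k has 2-power order since |N| = 2^(b+1) k. *)
Lemma scalings_expg_pred s : s \in N ->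
  s ^+ #|K|.-1 \in [set y ^+ 2 | y in 'O_2(N)].
Proof.
move=> Ns; rewrite card_pred mulnC expgM; apply: imset_f.
have nilN := abelian_nil (cyclic_abelian (scalings_cyclic L)).
have hallN := nilpotent_pcore_Hall 2 nilN.
rewrite (mem_normal_Hall hallN) ?pcore_normal ?groupX //.
have : #[s ^+ k] %| 2 ^ b.+1.
  rewrite order_dvdn -expgM mulnC -card_scalings_mersenne.
  by rewrite -order_dvdn order_dvdG.
by move/pnat_dvd; apply; rewrite pnatX.
Qed.

Lemma order_frobenius2 : #[phi] = 2.
Proof. by rewrite frobenius_order_prime dimL. Qed.

Lemma frobenius_expg2 : phi ^+ 2 = 1.
Proof. by apply/eqP; rewrite -order_dvdn order_frobenius2. Qed.

Lemma card_mul_frobenius (A : {group {perm V}}) :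
  A \subset N -> #|A * <[phi]>| = (2 * #|A|)%N.
Proof.
move=> sAN; rewrite TI_cardMg -?orderE ?order_frobenius2 1?mulnC //.
by apply/trivgP; rewrite -(scalings_frobenius_TI L) setSI.
Qed.

(** A generator of O_2(N) and phi satisfy the semidihedral presentation, because
    q = 2^b - 1; the surjection it gives is bijective since both groups have order
    2^(b+2). *)
Lemma O2_frobenius_isog : 'O_2(N) <*> <[phi]> \isog 'SD_(2 ^ (b + 2)).
Proof.
have b_gt1 := mersenne_exponent_gt1.
have sON : 'O_2(N) \subset N := pcore_sub 2 N.
have [x defO] := cyclicP (cyclicS sON (scalings_cyclic L)).
have ox : #[x] = (2 ^ b.+1)%N by rewrite orderE -defO card_O2_scalings.
have Nx : x \in N by rewrite (subsetP sON) // defO cycle_id.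
rewrite addn2 isogEcard; apply/andP; split; last first.
  rewrite card_semidihedral //= norm_joinEr ?frobenius_norm //.
  by rewrite card_mul_frobenius // card_O2_scalings -expnS.
rewrite Grp_semidihedral //; apply/existsP; exists (x, phi); rewrite /= -defO.
have xn : x ^+ (2 ^ b.+1) = 1 by rewrite -ox expg_order.
by rewrite xn frobenius_expg2 scaling_conj_frobenius // cardK subn1 !eqxx.
Qed.

(** On elements of order dividing q + 1 = 2^b, the q-th power map of phi is
    inversion, which is the dihedral relation; the orders agree as before. *)
Lemma squares_frobenius_isog x :
  'O_2(N) = <[x]> -> <[x ^+ 2]> <*> <[phi]> \isog 'D_(2 ^ (b + 1)).
Proof.
move=> defO; have b1_gt1 : (1 < b.+1)%N := ltnW mersenne_exponent_gt1.
have ox : #[x] = (2 ^ b.+1)%N by rewrite orderE -defO card_O2_scalings.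
have Nx : x \in N by rewrite (subsetP (pcore_sub 2 N)) // defO cycle_id.
have ox2 : #[x ^+ 2] = (2 ^ b)%N.
  by rewrite orderXdiv ox expnS ?dvdn_mulr // mulKn.
have sXN : <[x ^+ 2]> \subset N by rewrite cycle_subG groupX.
rewrite addn1 isogEcard; apply/andP; split; last first.
  rewrite card_2dihedral //= norm_joinEr ?frobenius_norm //.
  by rewrite card_mul_frobenius // -orderE ox2 -expnS.
rewrite Grp_2dihedral //; apply/existsP; exists (x ^+ 2, phi); rewrite /=.
have -> : (x ^+ 2) ^ phi = (x ^+ 2)^-1.
  rewrite scaling_conj_frobenius ?groupX //; apply/eqP.
  rewrite eq_sym eq_invg_mul -expgS cardK subn1 prednK ?expn_gt0 //.
  by rewrite -ox2 expg_order.
have x2n : (x ^+ 2) ^+ (2 ^ b) = 1 by rewrite -ox2 expg_order.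
by rewrite x2n frobenius_expg2 !eqxx.
Qed.

(** Both choices of P are of the form A <phi> with A between the squares of O_2(N)
    and O_2(N). Since C is central, G is both (A <phi>) C, a 2-group times a central
    abelian group, and (A C) <phi>, a group of scalings extended by phi. *)
Lemma mul_frobenius_central_mul (A C : {group {perm V}}) :
    A \subset 'O_2(N) -> [set y ^+ 2 | y in 'O_2(N)] \subset A ->
    C \subset 'O_2^'(N) ->
  let G := A * <[phi]> * C in
  [/\ group_set G, G \subset semilinear_group L,
      irreducible_linear_group G
    & [/\ nilpotent G, linear_ibis G & linear_base_size G = 2]].
Proof.
move=> sAO sqA sCO /=; have cNN := cyclic_abelian (scalings_cyclic L).
have sAN : A \subset N := subset_trans sAO (pcore_sub 2 N).
have sCN : C \subset N := subset_trans sCO (pcore_sub 2^' N).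
have cAC : C \subset 'C(A) by rewrite (sub_abelian_cent2 cNN).
have cPhiC : C \subset 'C(<[phi]>).
  rewrite cent_cycle; apply/subsetP=> c Cc; apply/cent1P/commgP/conjg_fixP.
  rewrite scaling_conj_frobenius ?(subsetP sCN) //.
  rewrite -(ltn_predK (finNzRing_gt1 K)) expgS card_pred mulnC expgM.
  by rewrite O2'_scalings_expg ?(subsetP sCO) // expg1n mulg1.
pose P := (A <*> <[phi]>)%G; pose G := (P <*> C)%G.
have defP : P :=: A * <[phi]> by rewrite /= norm_joinEr ?frobenius_norm.
have cPC : C \subset 'C(P) by rewrite defP centM subsetI cAC.
have defG : G :=: P * C by rewrite /= cent_joinEr.
have sACN : A <*> C \subset N by rewrite join_subG sAN.
have defG' : G :=: (A <*> C) * <[phi]>.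
  by rewrite defG defP /= cent_joinEr // -!mulgA (centC cPhiC).
have nilG : nilpotent G.
  rewrite defG mulg_nil // (abelian_nil (abelianS sCN cNN)) andbT.
  apply: (@pgroup_nil _ 2); rewrite defP pgroupM.
  by rewrite (pgroupS sAO (pcore_pgroup _ _)) /pgroup -orderE order_frobenius2.
have powH s : s \in N -> s ^+ #|K|.-1 \in A <*> C.
  by move/scalings_expg_pred/(subsetP sqA)/(subsetP (joing_subl A C)).
have dimL_prime : prime (\dim {:L}) by rewrite dimL.
have [ibisG baseG] := scalings_frobenius_ibis sACN defG' powH dimL_prime.
rewrite -defP -defG; split=> //; first exact: groupP.
  by rewrite defG' semilinear_groupE mulSg.
exact: scalings_frobenius_irreducible sACN defG' powH dimL.
Qed.

End Mersenne.

Theorem proposition1p6 (b : nat) (K : finFieldType) (L : fieldExtType K)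
    (r_prime : prime (2 ^ b - 1)%N)
    (cardK : #|K| = (2 ^ b - 1)%N)
    (dimL : \dim {:L} = 2) :
  [/\ semilinear_group L = scalings L * <[frobenius L]>,
      [/\ group_set (P1 L), P1 L \subset semilinear_group L
        & P1 L \isog 'SD_(2 ^ (b + 2))],
      [/\ group_set (P2 L), P2 L \subset semilinear_group L
        & P2 L \isog 'D_(2 ^ (b + 1))]
    & forall (P G : {set {perm finvect_type L}})
             (C : {group {perm finvect_type L}}),
        P = P1 L \/ P = P2 L ->
        C \subset 'O_2^'(scalings L) ->
        G = P * C ->
        [/\ group_set G, G \subset semilinear_group L,
            irreducible_linear_group G
          & [/\ nilpotent G, linear_ibis G & linear_base_size G = 2]]].
Proof.
have sON : 'O_2(scalings L) \subset scalings L := pcore_sub 2 (scalings L).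
have [x defO] := cyclicP (cyclicS sON (scalings_cyclic L)).
have sXO : <[x ^+ 2]> \subset 'O_2(scalings L) by rewrite defO cycleX.
have sXN := subset_trans sXO sON.
have sqE : [set y ^+ 2 | y in 'O_2(scalings L)] = <[x ^+ 2]>.
  by rewrite defO imset_expg_cycle.
have P1E : P1 L = 'O_2(scalings L) <*> <[frobenius L]>.
  by rewrite norm_joinEr ?frobenius_norm.
have P2E : P2 L = <[x ^+ 2]> <*> <[frobenius L]>.
  by rewrite /P2 sqE norm_joinEr ?frobenius_norm.
split; first exact: semilinear_groupE.
- split; first by rewrite P1E groupP.
    by rewrite semilinear_groupE mulSg.
  by rewrite P1E; apply: O2_frobenius_isog.
- split; first by rewrite P2E groupP.
    by rewrite semilinear_groupE /P2 sqE mulSg.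
  by rewrite P2E; apply: squares_frobenius_isog.
move=> P G C [] -> sCO ->; rewrite /P1 /P2 ?sqE.
  by apply: (mul_frobenius_central_mul r_prime) => //; rewrite sqE.
by apply: (mul_frobenius_central_mul r_prime) => //; rewrite sqE.
Qed.
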